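(* Let $(X,d)$ be a nonempty metric space and let $k\geq 2$ be an integer. The functors $\mathcal F_k:\mathbf{PowPres}_k(X)\to\mathbf{PowStr}_k(X)$ and $\mathcal G_k:\mathbf{PowStr}_k(X)\to\mathbf{PowPres}_k(X)$ (defined in the context) define an equivalence of categories. Moreover, $\mathcal F_k\mathcal G_k=\mathrm{id}_{\mathbf{PowStr}_k(X)}$ and $\mathcal G_k\mathcal F_k\cong\mathrm{id}_{\mathbf{PowPres}_k(X)}$ through the natural isomorphism $\eta$ with components $\eta_{(P,\phi)}=\bar q_1^\phi$. Consequently, the isomorphism classes of ordered $k$-power presentations of $(X,d)$ (objects of $\mathbf{PowPres}_k(X)$) correspond bijectively to ordered $k$-power structures on $(X,d)$. The category $\mathbf{PowPres}_k(X)$ is thin (at most one morphism between any two objects), and every ordered $k$-power presentation has trivial automorphism group.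
   Context: All metric spaces are nonempty and all isometries are bijective. $\Delta_k(P)$ is $P^k$ with metric $d_{P^k}(p,q)=\max_{1\le j\le k}d_P(p_j,q_j)$; $\pi_j:P^k\to P$ is the $j$-th projection; for $f:P\to Q$, $f^{\times k}:P^k\to Q^k$ is the coordinatewise map. For an equivalence relation $E$ on $X$, $\bar d_E([x]_E,[y]_E):=\inf\{d(x',y'):x'Ex,\ y'Ey\}$. Category $\mathbf{PowPres}_k(X)$: objects are pairs $(P,\phi)$ with $(P,d_P)$ a metric space and $\phi:\Delta_k(P)\to(X,d)$ an isometry; a morphism $(P,\phi)\to(Q,\psi)$ is an isometry $f:P\to Q$ with $\psi\circ f^{\times k}=\phi$. An ordered $k$-power structure on $(X,d)$ is a tuple $(E_1,\dots,E_k,\tau_2,\dots,\tau_k)$ with $E_j$ equivalence relations on $X$ and $\tau_j:X/E_j\to X/E_1$ ($2\le j\le k$) maps such that: (i) each $\bar d_{E_j}$ is a metric on $X/E_j$; (ii) for all classes $C_j\in X/E_j$ ($1\le j\le k$), $\bigcap_{j=1}^kC_j$ is exactly one point; (iii) $d(x,y)=\max_{1\le j\le k}\bar d_{E_j}([x]_{E_j},[y]_{E_j})$ for all $x,y\in X$; (iv) each $\tau_j:(X/E_j,\bar d_{E_j})\to(X/E_1,\bar d_{E_1})$ is an isometry. $\mathbf{PowStr}_k(X)$ is the discrete category of such structures. $\mathcal F_k$: given $(P,\phi)$, put $q_j^\phi:=\pi_j\circ\phi^{-1}:X\to P$, let $xE_j^\phi y$ iff $q_j^\phi(x)=q_j^\phi(y)$,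 let $\bar q_j^\phi:X/E_j^\phi\to P$ be the induced map, and $\tau_j^\phi:=(\bar q_1^\phi)^{-1}\circ\bar q_j^\phi$. Then $\mathcal F_k(P,\phi):=(E_1^\phi,\dots,E_k^\phi,\tau_2^\phi,\dots,\tau_k^\phi)$; a morphism $(P,\phi)\to(Q,\psi)$ is sent to the identity of the common value $\mathcal F_k(P,\phi)=\mathcal F_k(Q,\psi)$. $\mathcal G_k$: given $\mathfrak s=(E_1,\dots,E_k,\tau_2,\dots,\tau_k)$, put $P_{\mathfrak s}:=(X/E_1,\bar d_{E_1})$ and $\Psi_{\mathfrak s}(x)=([x]_{E_1},\tau_2([x]_{E_2}),\dots,\tau_k([x]_{E_k}))\in P_{\mathfrak s}^k$; then $\mathcal G_k(\mathfrak s):=(P_{\mathfrak s},\Psi_{\mathfrak s}^{-1})$, and identities go to identities. *)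

(* Defs.v *)
From HB Require Import structures.
From Stdlib Require Import RelationClasses.
From mathcomp Require Import all_boot all_order all_algebra.
From mathcomp Require Import boolp classical_sets reals topology.

Set Implicit Arguments.
Unset Strict Implicit.
Unset Printing Implicit Defensive.

Import Order.TTheory GRing.Theory Num.Theory.

Local Open Scope classical_set_scope.
Local Open Scope ring_scope.

Record category := Category {
  ob :> Type;
  mor : ob -> ob -> Type;
  idm : forall a, mor a a;
  compm : forall a b c, mor b c -> mor a b -> mor a c;
  compm1 : forall a b (f : mor a b), compm f (idm a) = f;
  comp1m : forall a b (f : mor a b), compm (idm b) f = f;
  compmA : forall a b c d (h : mor c d) (g : mor b c) (f : mor a b),
    compm h (compm g f) = compm (compm h g) f }.

Definition is_iso (C : category) (a b : C) (f : mor a b) : Prop :=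
  exists g : mor b a, compm g f = idm a /\ compm f g = idm b.

Definition isomorphic (C : category) (a b : C) : Prop :=
  exists f : mor a b, is_iso f.

Definition iso_classes (C : category) : Type :=
  {S : C -> Prop | exists a, S = isomorphic a}.

Definition iso_class (C : category) (a : C) : iso_classes C :=
  exist _ (isomorphic a) (ex_intro _ a erefl).

Definition thin (C : category) : Prop :=
  forall (a b : C) (f g : mor a b), f = g.

Definition trivial_aut (C : category) (a : C) : Prop :=
  forall f : mor a a, is_iso f -> f = idm a.

Record functor (C D : category) := Functor {
  fobj :> C -> D;
  fmap : forall a b : C, mor a b -> mor (fobj a) (fobj b);
  fmap1 : forall a : C, fmap (idm a) = idm (fobj a);
  fmapM : forall (a b c : C) (g : mor b c) (f : mor a b),
    fmap (compm g f) = compm (fmap g) (fmap f) }.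

Definition functor_id (C : category) : functor C C :=
  @Functor C C (fun a => a) (fun _ _ f => f)
    (fun=> erefl) (fun _ _ _ _ _ => erefl).

Section FunctorComp.
Context (C D E : category) (G : functor D E) (F : functor C D).

Fact functor_comp1 (a : C) : fmap G (fmap F (idm a)) = idm (G (F a)).
Proof. by rewrite !fmap1. Qed.

Fact functor_compM (a b c : C) (g : mor b c) (f : mor a b) :
  fmap G (fmap F (compm g f)) =
  compm (fmap G (fmap F g)) (fmap G (fmap F f)).
Proof. by rewrite !fmapM. Qed.

Definition functor_comp : functor C E :=
  @Functor C E (fun a => G (F a)) (fun _ _ f => fmap G (fmap F f))
    functor_comp1 functor_compM.

End FunctorComp.

Record nat_iso (C D : category) (F G : functor C D) := NatIso {
  nat_comp :> forall a : C, mor (F a) (G a);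
  nat_natural : forall (a b : C) (f : mor a b),
    compm (fmap G f) (nat_comp a) = compm (nat_comp b) (fmap F f);
  nat_invertible : forall a : C, is_iso (nat_comp a) }.

Definition is_equivalence (C D : category)
    (F : functor C D) (G : functor D C) : Prop :=
  inhabited (nat_iso (functor_comp G F) (functor_id C)) /\
  inhabited (nat_iso (functor_comp F G) (functor_id D)).

Fact discrete_comp1 (T : Type) (a b : T) (f : a = b) :
  etrans (erefl a) f = f.
Proof. by case: b / f. Qed.

Fact discrete_compA (T : Type) (a b c d : T)
    (h : c = d) (g : b = c) (f : a = b) :
  etrans (etrans f g) h = etrans f (etrans g h).
Proof. by case: d / h; case: c / g. Qed.

(* A morphism a -> b is a proof of a = b; by proof irrelevance
   (discrete_thin) the only morphisms are identities. *)
Definition discrete (T : Type) : category :=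
  @Category T (fun a b => a = b) (fun a => erefl a)
    (fun a b c g f => etrans f g)
    (@discrete_comp1 T) (fun _ _ _ => erefl) (@discrete_compA T).

Lemma discrete_thin (T : Type) : thin (discrete T).
Proof. by move=> a b f g; exact: (@Prop_irrelevance (a = b) f g). Qed.

(* Elements of [quot E] are the classes themselves, as subsets of T; the
   intended use is for an equivalence relation E. *)
Definition quot (T : Type) (E : T -> T -> Prop) : Type :=
  {C : set T | exists x, C = [set y | E x y]}.

Definition cls (T : Type) (E : T -> T -> Prop) (x : T) : quot E :=
  exist _ [set y | E x y] (ex_intro _ x erefl).

Definition quot_repr (T : Type) (E : T -> T -> Prop) (C : quot E) : T :=
  sval (cid (svalP C)).

(* Computed on a chosen representative; see induced_cls for independence of
   that choice when f is constant on classes. *)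
Definition induced (T U : Type) (E : T -> T -> Prop) (f : T -> U)
  (C : quot E) : U := f (quot_repr C).

Lemma quot_ext (T : Type) (E : T -> T -> Prop) (C D : quot E) :
  sval C = sval D -> C = D.
Proof.
case: C D => C hC [D hD] /= CD; case: D / CD hD => hD.
by congr exist; exact: Prop_irrelevance.
Qed.

Lemma cls_reprK (T : Type) (E : T -> T -> Prop) (C : quot E) :
  cls E (quot_repr C) = C.
Proof.
by apply: quot_ext; rewrite /quot_repr; case: (cid (svalP C)) => x /= ->.
Qed.

Lemma cls_eqP (T : Type) (E : T -> T -> Prop) (x y : T) :
  Equivalence E -> cls E x = cls E y <-> E x y.
Proof.
move=> [Er Es Et]; split=> [/(congr1 (@sval _ _))/= e|Exy].
  have : [set z | E y z] y by exact: Er.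
  by rewrite -e.
apply: quot_ext; apply/seteqP; split=> z /= Ez.
  exact: (Et _ _ _ (Es _ _ Exy) Ez).
exact: (Et _ _ _ Exy Ez).
Qed.

Lemma induced_cls (T U : Type) (E : T -> T -> Prop) (f : T -> U) (x : T) :
  Equivalence E -> (forall y z, E y z -> f y = f z) ->
  induced f (cls E x) = f x.
Proof.
move=> Eeq fE; apply: fE; apply/(cls_eqP _ _ Eeq); exact: cls_reprK.
Qed.

Fact bijective_ex (A B : Type) (f : A -> B) :
  bijective f -> exists g : B -> A, cancel f g /\ cancel g f.
Proof. by case=> g fK gK; exists g. Qed.

Definition inverse (A B : Type) (f : A -> B) (bf : bijective f) : B -> A :=
  sval (cid (bijective_ex bf)).

Lemma inverseK (A B : Type) (f : A -> B) (bf : bijective f) :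
  cancel f (inverse bf).
Proof. by rewrite /inverse; case: cid => g /= []. Qed.

Lemma inverseKV (A B : Type) (f : A -> B) (bf : bijective f) :
  cancel (inverse bf) f.
Proof. by rewrite /inverse; case: cid => g /= []. Qed.

Section Metrics.
Context (R : realType).

Record is_metric (T : Type) (d : T -> T -> R) : Prop := IsMetric {
  is_metric_ge0 : forall x y, 0 <= d x y;
  is_metric_eq0 : forall x y, d x y = 0 <-> x = y;
  is_metric_sym : forall x y, d x y = d y x;
  is_metric_triangle : forall x y z, d x z <= d x y + d y z }.

Definition is_isometry (A B : Type) (dA : A -> A -> R) (dB : B -> B -> R)
    (f : A -> B) : Prop :=
  bijective f /\ forall x y, dB (f x) (f y) = dA x y.

Lemma is_isometry_inverse (A B : Type) (dA : A -> A -> R) (dB : B -> B -> R)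
    (f : A -> B) (hf : is_isometry dA dB f) (bf : bijective f) :
  is_isometry dB dA (inverse bf).
Proof.
split; first by exists f; [exact: inverseKV|exact: inverseK].
by move=> x y; rewrite -(proj2 hf) !inverseKV.
Qed.

Lemma is_isometry_comp (A B C : Type) (dA : A -> A -> R) (dB : B -> B -> R)
    (dC : C -> C -> R) (g : B -> C) (f : A -> B) :
  is_isometry dB dC g -> is_isometry dA dB f -> is_isometry dA dC (g \o f).
Proof.
move=> [bg dg] [bf df]; split; first exact: bij_comp.
by move=> x y /=; rewrite dg df.
Qed.

Lemma is_metric_mdist (M : metricType R) : is_metric (@mdist R M).
Proof.
split; [exact: mdist_ge0| |exact: metric_sym|].
  by move=> x y; split=> [|->]; [exact: mdist_positivity|exact: mdistxx].
by move=> x y z; exact: metric_triangle.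
Qed.

Lemma is_metric_isometry (A B : Type) (dA : A -> A -> R) (dB : B -> B -> R)
    (f : A -> B) : is_isometry dA dB f -> is_metric dB -> is_metric dA.
Proof.
move=> [bf df] [d0 deq ds dt]; split=> [x y|x y|x y|x y z]; rewrite -!df //.
by rewrite deq; split=> [/(bij_inj bf)|->].
Qed.

Definition metric_carrier (T : Type) (d : T -> T -> R) (_ : is_metric d) :=
  T.

Section MetricOf.
Context (T : Type) (d : T -> T -> R) (dm : is_metric d).
HB.instance Definition _ := gen_eqMixin (metric_carrier dm).
HB.instance Definition _ := gen_choiceMixin (metric_carrier dm).
HB.instance Definition _ := @isMetric.Build R (metric_carrier dm) d
  (fun x => proj2 (is_metric_eq0 dm x x) erefl)
  (fun x y => proj1 (is_metric_eq0 dm x y))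
  (is_metric_sym dm)
  (fun y x z => is_metric_triangle dm x y z).
End MetricOf.

Definition metric_of (T : Type) (d : T -> T -> R) (dm : is_metric d) :
  metricType R := metric_carrier dm.

(* The maximum starts from 0, which is harmless as distances are
   nonnegative (and k > 0 below). *)
Definition max_dist (k : nat) (T : 'I_k -> Type)
    (d : forall j, T j -> T j -> R) (p q : forall j, T j) : R :=
  \big[Num.max/0]_(j < k) d j (p j) (q j).

Lemma max_dist_ge0 (k : nat) (T : 'I_k -> Type)
    (d : forall j, T j -> T j -> R) (p q : forall j, T j) :
  0 <= max_dist d p q.
Proof. exact: bigmax_ge_id. Qed.

Lemma le_max_dist (k : nat) (T : 'I_k -> Type)
    (d : forall j, T j -> T j -> R) (p q : forall j, T j) (j : 'I_k) :
  d j (p j) (q j) <= max_dist d p q.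
Proof. by rewrite /max_dist; exact: (le_bigmax 0 (fun j => d j (p j) (q j))). Qed.

Lemma max_dist_le (k : nat) (T : 'I_k -> Type)
    (d : forall j, T j -> T j -> R) (p q : forall j, T j) (r : R) :
  0 <= r -> (forall j, d j (p j) (q j) <= r) -> max_dist d p q <= r.
Proof. by move=> r0 h; apply: bigmax_le. Qed.

Lemma is_metric_max_dist (k : nat) (T : 'I_k -> Type)
    (d : forall j, T j -> T j -> R) :
  (forall j, is_metric (d j)) -> is_metric (max_dist d).
Proof.
move=> dm; split=> [p q|p q|p q|p q r].
- exact: max_dist_ge0.
- split=> [pq|->].
    apply: functional_extensionality_dep => j; apply/(is_metric_eq0 (dm j)).
    apply/eqP; rewrite eq_le (is_metric_ge0 (dm j)) andbT -pq.
    exact: le_max_dist.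
  apply/eqP; rewrite eq_le max_dist_ge0 andbT; apply: max_dist_le => // j.
  by rewrite (proj2 (is_metric_eq0 (dm j) _ _)).
- by apply: eq_bigr => j _; rewrite (is_metric_sym (dm j)).
- apply: max_dist_le; first by rewrite addr_ge0 ?max_dist_ge0.
  move=> j; apply: le_trans (is_metric_triangle (dm j) _ (q j) _) _.
  by apply: lerD; exact: le_max_dist.
Qed.

Fact is_metric_Delta (k : nat) (P : metricType R) :
  is_metric (@max_dist k (fun=> P) (fun=> @mdist R P)).
Proof. by apply: is_metric_max_dist => j; exact: is_metric_mdist. Qed.

Definition Delta (k : nat) (P : metricType R) : metricType R :=
  metric_of (is_metric_Delta k P).

Definition power_map (k : nat) (P Q : metricType R) (f : P -> Q) :
  Delta k P -> Delta k Q := fun p j => f (p j).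

Definition quotient_dist (X : metricType R) (E : X -> X -> Prop)
    (C D : quot E) : R :=
  inf [set mdist x y | x in sval C & y in sval D].

End Metrics.

Section PowPres.
Context (R : realType) (X : metricType R) (k : nat).

Record pow_pres := PowPres {
  pp_space : metricType R;
  pp_nonempty : [set: pp_space] !=set0;
  pp_map : Delta k pp_space -> X;
  pp_isometry : is_isometry mdist mdist pp_map }.

Arguments pp_map : clear implicits.
Arguments pp_isometry : clear implicits.

Record pp_hom (A B : pow_pres) := PPHom {
  pp_fun :> pp_space A -> pp_space B;
  pp_fun_isometry : is_isometry mdist mdist pp_fun;
  pp_fun_compat : pp_map B \o power_map pp_fun = pp_map A }.

Lemma pp_hom_ext (A B : pow_pres) (f g : pp_hom A B) : f =1 g -> f = g.
Proof.
case: f => f f1 f2; case: g => g g1 g2 /= /funext fg.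
rewrite -{}fg in g1 g2 *.
by rewrite (Prop_irrelevance f1 g1) (Prop_irrelevance f2 g2).
Qed.

Fact pp_id_isometry (A : pow_pres) :
  is_isometry mdist mdist (@id (pp_space A)).
Proof. by split=> //; exists id. Qed.

Definition pp_id (A : pow_pres) : pp_hom A A :=
  @PPHom A A id (pp_id_isometry A) erefl.

Section Comp.
Context (A B C : pow_pres) (g : pp_hom B C) (f : pp_hom A B).

Fact pp_comp_compat : pp_map C \o power_map (g \o f) = pp_map A.
Proof. by rewrite -(pp_fun_compat f) -(pp_fun_compat g). Qed.

Definition pp_comp : pp_hom A C :=
  @PPHom A C (g \o f)
    (is_isometry_comp (pp_fun_isometry g) (pp_fun_isometry f))
    pp_comp_compat.
End Comp.

Fact pp_compm1 (A B : pow_pres) (f : pp_hom A B) : pp_comp f (pp_id A) = f.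
Proof. exact: pp_hom_ext. Qed.

Fact pp_comp1m (A B : pow_pres) (f : pp_hom A B) : pp_comp (pp_id B) f = f.
Proof. exact: pp_hom_ext. Qed.

Fact pp_compmA (A B C D : pow_pres)
    (h : pp_hom C D) (g : pp_hom B C) (f : pp_hom A B) :
  pp_comp h (pp_comp g f) = pp_comp (pp_comp h g) f.
Proof. exact: pp_hom_ext. Qed.

Definition PowPresCat : category :=
  @Category pow_pres pp_hom pp_id pp_comp pp_compm1 pp_comp1m pp_compmA.

End PowPres.

Arguments pp_map {R X k} p _.
Arguments pp_isometry {R X k} p.

(* Indices are numbered 0, ..., k-1, so E_1 is [ps_rel s (first_ord hk)], and
   the tau_j with 2 <= j <= k are the [ps_tau hj] with hj : 0 < j. *)
Definition first_ord (k : nat) (hk : (2 <= k)%N) : 'I_k :=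
  Ordinal (ltnW hk).

Section PowStr.
Context (R : realType) (X : metricType R) (k : nat) (hk : (2 <= k)%N).
Local Notation i1 := (first_ord hk).

Record pow_str := PowStr {
  ps_rel : 'I_k -> X -> X -> Prop;
  ps_tau : forall j : 'I_k, (0 < j)%N ->
    quot (ps_rel j) -> quot (ps_rel i1);
  ps_equiv : forall j, Equivalence (ps_rel j);
  ps_metric : forall j, is_metric (@quotient_dist R X (ps_rel j));
  ps_point : forall C : (forall j, quot (ps_rel j)),
    exists x, \bigcap_j sval (C j) = [set x];
  ps_max : forall x y : X,
    mdist x y = max_dist (fun j => @quotient_dist R X (ps_rel j))
                  (fun j => cls (ps_rel j) x) (fun j => cls (ps_rel j) y);
  ps_tau_isometry : forall (j : 'I_k) (hj : (0 < j)%N),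
    is_isometry (@quotient_dist R X (ps_rel j))
                (@quotient_dist R X (ps_rel i1)) (ps_tau hj) }.

Definition PowStrCat : category := discrete pow_str.

Lemma pow_str_ext (s t : pow_str) :
  (forall j x y, ps_rel s j x y <-> ps_rel t j x y) ->
  (forall (j : 'I_k) (hj : (0 < j)%N) x y,
     ps_tau hj (cls (ps_rel s j) x) = cls (ps_rel s i1) y ->
     ps_tau hj (cls (ps_rel t j) x) = cls (ps_rel t i1) y) ->
  s = t.
Proof.
case: s => E u e1 e2 e3 e4 e5; case: t => E' u' e1' e2' e3' e4' e5' /= hE.
have EE : E = E'.
  by apply/funext => j; apply/funext => x; apply/funext => y; apply/propext.
case: E' / EE u' e1' e2' e3' e4' e5' {hE} => u' e1' e2' e3' e4' e5' hu.
have uu : u = u'.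
  apply: functional_extensionality_dep => j.
  apply: functional_extensionality_dep => hj.
  apply/funext => C; rewrite -(cls_reprK C) -[LHS]cls_reprK.
  by apply/esym/hu; rewrite !cls_reprK.
case: u' / uu e5' {hu} => e5'.
by congr PowStr; exact: Prop_irrelevance.
Qed.

Section F.
Context (A : pow_pres X k).
Local Notation P := (pp_space A).

Definition pp_coord (j : 'I_k) : X -> P :=
  fun x => inverse (proj1 (pp_isometry A)) x j.

Definition pp_rel (j : 'I_k) (x y : X) : Prop :=
  pp_coord j x = pp_coord j y.

Definition pp_qbar (j : 'I_k) : quot (pp_rel j) -> P :=
  induced (pp_coord j).

Fact pp_rel_equiv (j : 'I_k) : Equivalence (pp_rel j).
Proof. by rewrite /pp_rel; split=> // x y z -> . Qed.

Lemma pp_coord_map (j : 'I_k) (p : Delta k P) : pp_coord j (pp_map A p) = p j.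
Proof. by rewrite /pp_coord inverseK. Qed.

Lemma pp_qbar_cls (j : 'I_k) (x : X) :
  pp_qbar (cls (pp_rel j) x) = pp_coord j x.
Proof. by apply: induced_cls => //; exact: pp_rel_equiv. Qed.

Lemma pp_dist (x y : X) : mdist x y =
  max_dist (fun=> @mdist R P) (pp_coord^~ x) (pp_coord^~ y).
Proof. by rewrite -(proj2 (is_isometry_inverse (pp_isometry A) (proj1 (pp_isometry A)))). Qed.

Lemma pp_qbar_bij (j : 'I_k) : bijective (@pp_qbar j).
Proof.
pose c (p : P) : Delta k P := fun=> p.
exists (fun p => cls (pp_rel j) (pp_map A (c p))) => [C|p].
  rewrite -[C]cls_reprK pp_qbar_cls; apply/(cls_eqP _ _ (pp_rel_equiv j)).
  by rewrite /pp_rel pp_coord_map.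
by rewrite pp_qbar_cls pp_coord_map.
Qed.

Lemma pp_qbar_isometry (j : 'I_k) :
  is_isometry (@quotient_dist R X (pp_rel j)) mdist (@pp_qbar j).
Proof.
split; first exact: pp_qbar_bij.
move=> C D; rewrite -[C]cls_reprK -[D]cls_reprK !pp_qbar_cls.
move: (quot_repr C) (quot_repr D) => {C D} x y; rewrite /quotient_dist /=.
set S := [set _ | _ in _ & _ in _].
have lbS : lbound S (mdist (pp_coord j x) (pp_coord j y)).
  move=> _ [x' /= -> [y' /= -> <-]]; rewrite pp_dist.
  exact: (le_max_dist (fun=> @mdist R P) (pp_coord^~ x') (pp_coord^~ y')).
have inS : S (mdist (pp_coord j x) (pp_coord j y)).
  pose c z : Delta k P := fun=> pp_coord j z.
  exists (pp_map A (c x)); first by rewrite /= /pp_rel pp_coord_map.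
  exists (pp_map A (c y)); first by rewrite /= /pp_rel pp_coord_map.
  rewrite (proj2 (pp_isometry A)); apply/eqP; rewrite eq_le.
  apply/andP; split; first by apply: max_dist_le => //; exact: mdist_ge0.
  exact: (le_max_dist (fun=> @mdist R P) (c x) (c y) j).
apply/eqP; rewrite eq_le; apply/andP; split.
  by apply: lb_le_inf => //; exists (mdist (pp_coord j x) (pp_coord j y)).
by apply: ge_inf => //; exists (mdist (pp_coord j x) (pp_coord j y)).
Qed.

Definition pp_tau (j : 'I_k) (_ : (0 < j)%N) :
    quot (pp_rel j) -> quot (pp_rel i1) :=
  inverse (pp_qbar_bij i1) \o @pp_qbar j.

Fact pp_quotient_metric (j : 'I_k) :
  is_metric (@quotient_dist R X (pp_rel j)).
Proof.
exact: is_metric_isometry (pp_qbar_isometry j) (is_metric_mdist _).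
Qed.

Fact pp_point (C : forall j, quot (pp_rel j)) :
  exists x, \bigcap_j sval (C j) = [set x].
Proof.
have CE j z : sval (C j) z <-> pp_coord j z = pp_qbar (C j).
  rewrite -{1}[C j]cls_reprK /= /pp_rel -pp_qbar_cls cls_reprK.
  by split=> ->.
exists (pp_map A ((fun j => pp_qbar (C j)) : Delta k P)).
apply/seteqP; split=> [z zC|z -> j _] /=; last first.
  by apply/CE; rewrite pp_coord_map.
rewrite -[z](inverseKV (proj1 (pp_isometry A))); congr (pp_map A).
by apply/funext => j; apply/CE; exact: zC.
Qed.

Fact pp_max (x y : X) :
  mdist x y = max_dist (fun j => @quotient_dist R X (pp_rel j))
                (fun j => cls (pp_rel j) x) (fun j => cls (pp_rel j) y).
Proof.
rewrite pp_dist; apply: eq_bigr => j _.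
by rewrite -(proj2 (pp_qbar_isometry j)) !pp_qbar_cls.
Qed.

Fact pp_tau_isometry (j : 'I_k) (hj : (0 < j)%N) :
  is_isometry (@quotient_dist R X (pp_rel j))
              (@quotient_dist R X (pp_rel i1)) (pp_tau hj).
Proof.
apply: is_isometry_comp _ (pp_qbar_isometry j).
exact: is_isometry_inverse (pp_qbar_isometry i1) _.
Qed.

Definition F_ob : pow_str :=
  @PowStr pp_rel pp_tau pp_rel_equiv pp_quotient_metric pp_point pp_max
    pp_tau_isometry.

Lemma pp_tauP (j : 'I_k) (hj : (0 < j)%N) (x y : X) :
  pp_tau hj (cls (pp_rel j) x) = cls (pp_rel i1) y <->
  pp_coord j x = pp_coord i1 y.
Proof.
rewrite -!pp_qbar_cls /pp_tau /=; split=> [<-|->].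
  by rewrite inverseKV.
by rewrite inverseK.
Qed.

End F.

Lemma pp_hom_coord (A B : pow_pres X k) (f : pp_hom A B) (j : 'I_k) (x : X) :
  pp_coord B j x = f (pp_coord A j x).
Proof.
have [p <-] : exists p, pp_map A p = x.
  by exists (inverse (proj1 (pp_isometry A)) x); rewrite inverseKV.
by rewrite -{1}(pp_fun_compat f) /= !pp_coord_map.
Qed.

Fact F_hom (A B : pow_pres X k) (f : pp_hom A B) : F_ob A = F_ob B.
Proof.
have fI := bij_inj (proj1 (pp_fun_isometry f)).
apply: pow_str_ext => /= [j x y|j hj x y /pp_tauP e].
  by rewrite /pp_rel !(pp_hom_coord f); split=> [->|/fI].
by apply/pp_tauP; rewrite !(pp_hom_coord f) e.
Qed.

Definition F_functor : functor (PowPresCat X k) PowStrCat :=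
  @Functor (PowPresCat X k) PowStrCat F_ob F_hom
    (fun=> discrete_thin _ _) (fun _ _ _ _ _ => discrete_thin _ _).

Section G.
Context (X0 : [set: X] !=set0) (s : pow_str).

Definition ps_space : metricType R := metric_of (ps_metric s i1).

Definition ps_Psi (x : X) : Delta k ps_space := fun j =>
  match pselect (0 < j)%N with
  | left hj => ps_tau hj (cls (ps_rel s j) x)
  | right _ => cls (ps_rel s i1) x
  end.

Fact ps_nonempty : [set: ps_space] !=set0.
Proof. by case: X0 => x _; exists (cls (ps_rel s i1) x). Qed.

Lemma ord_eq_first (j : 'I_k) : ~ (0 < j)%N -> j = i1.
Proof. by move=> /negP; rewrite -leqNgt leqn0 => /eqP j0; apply: val_inj. Qed.

Lemma ps_Psi_dist (x y : X) (j : 'I_k) :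
  mdist (ps_Psi x j) (ps_Psi y j) =
  quotient_dist (cls (ps_rel s j) x) (cls (ps_rel s j) y).
Proof.
rewrite /ps_Psi; case: pselect => [hj|/ord_eq_first ->//].
exact: (proj2 (ps_tau_isometry s hj)).
Qed.

Fact ps_Psi_isometry : is_isometry mdist mdist ps_Psi.
Proof.
have dPsi x y : mdist (ps_Psi x) (ps_Psi y) = mdist x y.
  by rewrite [RHS](ps_max s); apply: eq_bigr => j _; exact: ps_Psi_dist.
have inj : injective ps_Psi.
  by move=> x y e; apply: mdist_positivity; rewrite -dPsi e mdistxx.
have surj p : exists x, ps_Psi x = p.
  have CP (j : 'I_k) : exists C : quot (ps_rel s j),
      forall x, cls (ps_rel s j) x = C -> ps_Psi x j = p j.
    rewrite /ps_Psi; case: pselect => [hj|/ord_eq_first ->]; last by exists (p i1).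
    have [g gK Kg] := proj1 (ps_tau_isometry s hj).
    by exists (g (p j)) => x ->.
  have [x xC] := @ps_point s (fun j => sval (cid (CP j))).
  exists x; apply/funext => j.
  have : (\bigcap_j sval (sval (cid (CP j)))) x by rewrite xC.
  move=> /(_ j I); case: (cid (CP j)) => C /= CPj Cx; apply: CPj.
  rewrite -[C]cls_reprK; rewrite -[C]cls_reprK /= in Cx.
  by apply/esym/(cls_eqP _ _ (ps_equiv s j)).
split=> //; exists (fun p => sval (cid (surj p))) => [x|p].
  by apply: inj; case: (cid _).
by case: (cid _).
Qed.

Definition G_ob : pow_pres X k :=
  @PowPres R X k ps_space ps_nonempty (inverse (proj1 ps_Psi_isometry))
    (is_isometry_inverse ps_Psi_isometry _).

End G.

Definition G_hom (X0 : [set: X] !=set0) (s t : pow_str) (e : s = t) :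
  pp_hom (G_ob X0 s) (G_ob X0 t) :=
  match e with erefl => pp_id (G_ob X0 s) end.

Fact G_homM (X0 : [set: X] !=set0) (s t u : pow_str)
    (g : t = u) (f : s = t) :
  G_hom X0 (etrans f g) = pp_comp (G_hom X0 g) (G_hom X0 f).
Proof. by case: u / g; case: t / f; apply: pp_hom_ext. Qed.

Definition G_functor (X0 : [set: X] !=set0) :
    functor PowStrCat (PowPresCat X k) :=
  @Functor PowStrCat (PowPresCat X k) (G_ob X0) (G_hom X0)
    (fun=> erefl) (G_homM X0).

End PowStr.

Arguments F_functor {R} X {k} hk.
Arguments G_functor {R X k} hk X0.

(* Main.v *)
Require Import Defs.
From mathcomp Require Import all_boot all_order all_algebra.
From mathcomp Require Import boolp classical_sets reals topology.

Set Implicit Arguments.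
Unset Strict Implicit.
Unset Printing Implicit Defensive.

Local Open Scope classical_set_scope.

(** A presentation is determined by its coordinate functions q_j = pi_j o phi^-1,
    because they recover phi^-1; and a morphism f : (P, phi) -> (Q, psi) is the
    same thing as an isometry with f o q_j^phi = q_j^psi for all j
    ([pp_hom_coord], [pp_hom_compat]).  Everything follows from this.

    Each q_j is onto, since P^k contains the diagonal, so f is forced by the
    equation f o q_1^phi = q_1^psi: the category of presentations is thin
    ([PowPresCat_thin]).  Hence naturality and the triviality of automorphism
    groups need no computation.  The inverse isometry of a morphism satisfies
    the reversed coordinate equations, so the category is moreover a groupoid
    ([pp_hom_iso]).

    The coordinates of G s are by construction the maps
    x |-> tau_j [x]_{E_j} (with tau_1 the identity), see [pp_coord_G].  As each
    tau_j is injective, the fibres of the j-th coordinate are the classes of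
    E_j, and comparing the j-th coordinate with the first gives back tau_j;
    so F G s = s on the nose ([F_G_ob]).

    In the other direction, the coordinates of G (F A) are
    qbar_1^-1 o qbar_j o [-]_{E_j} = qbar_1^-1 o q_j, which qbar_1 sends to q_j.
    Thus qbar_1 is a morphism G (F A) -> A ([pp_eta]), and it is a natural
    isomorphism by thinness and the groupoid property.

    The bijection between isomorphism classes and structures is then formal:
    for any equivalence of a category with a discrete one, the object map of
    the functor is a surjective complete isomorphism invariant
    ([equivalence_discrete_iso_classes]). *)

(** * Isomorphisms and equivalences with discrete categories *)

Lemma isomorphic_sym (C : category) (a b : C) :
  isomorphic a b -> isomorphic b a.
Proof. by case=> f [g [gf fg]]; exists g, f. Qed.

Lemma isomorphic_trans (C : category) (a b c : C) :
  isomorphic a b -> isomorphic b c -> isomorphic a c.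
Proof.
case=> f [f' [f'f ff']] [g [g' [g'g gg']]].
exists (compm g f), (compm f' g'); split.
  by rewrite -compmA (compmA g') g'g comp1m.
by rewrite -compmA (compmA f) ff' comp1m.
Qed.

Lemma is_iso_idm (C : category) (a : C) : is_iso (idm a).
Proof. by exists (idm a); rewrite compm1. Qed.

Lemma thin_trivial_aut (C : category) (a : C) : thin C -> trivial_aut a.
Proof. by move=> Cthin f _; exact: Cthin. Qed.

Lemma nat_iso_of_eq (C D : category) (F G : functor C D) :
  F = G -> inhabited (nat_iso F G).
Proof.
move=> ->; constructor; exists (fun a => idm (G a)) => [a b f|a].
  by rewrite comp1m compm1.
exact: is_iso_idm.
Qed.

(** Morphisms of a discrete category are proofs of equality, hence carry no
    information: only the object map of a functor into it matters. *)
Lemma functor_discrete_ext (C : category) (T : Type)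
    (F G : functor C (discrete T)) : (forall a, F a = G a) -> F = G.
Proof.
case: F => Fo Fm F1 FM; case: G => Go Gm G1 GM /= /funext FG.
case: Go / FG Gm G1 GM => Gm G1 GM.
have FmGm : Fm = Gm.
  do 2![apply: functional_extensionality_dep => ?].
  by apply/funext => f; exact: discrete_thin.
case: Gm / FmGm G1 GM => G1 GM.
by congr Functor; exact: Prop_irrelevance.
Qed.

(** The isomorphism class of [a] is the fibre of [f] over [f a], so evaluating
    [f] on a chosen representative loses nothing. *)
Lemma complete_invariant_bij (C : category) (T : Type) (f : C -> T) :
  (forall a b : C, isomorphic a b <-> f a = f b) ->
  (forall t, exists a, f a = t) ->
  exists b : iso_classes C -> T,
    bijective b /\ forall a : C, b (iso_class a) = f a.
Proof.
move=> f_inv f_surj.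
pose b (S : iso_classes C) : T := f (sval (cid (svalP S))).
have bE a : b (iso_class a) = f a.
  rewrite /b; case: (cid _) => a' /= aa'; apply/f_inv.
  by rewrite -aa'; apply/f_inv.
have class_eq a a' : f a = f a' -> iso_class a = iso_class a'.
  move=> faa'; apply: eq_exist.
  by apply/funext => c; apply/propext; rewrite !f_inv faa'.
have iso_classP (S : iso_classes C) : exists a, S = iso_class a.
  by case: S => S [a Sa]; exists a; apply: eq_exist.
exists b; split => //.
exists (fun t => iso_class (sval (cid (f_surj t)))) => [S|t].
  have [a ->] := iso_classP S; rewrite bE.
  by apply: class_eq; case: (cid _).
by rewrite bE; case: (cid _).
Qed.

Lemma equivalence_discrete_iso_classes (C : category) (T : Type)
    (F : functor C (discrete T)) (G : functor (discrete T) C) :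
  is_equivalence F G ->
  exists b : iso_classes C -> discrete T,
    bijective b /\ forall a : C, b (iso_class a) = F a.
Proof.
move=> [[eta] [eps]]; apply: complete_invariant_bij => [a b|t].
  have GFiso c : isomorphic (G (F c)) c.
    by exists (eta c); exact: (nat_invertible eta c).
  split=> [[f _]|Fab]; first exact: (Defs.fmap F f).
  apply: isomorphic_trans (isomorphic_sym (GFiso a)) _.
  by rewrite Fab; exact: GFiso.
by exists (G t); exact: eps t.
Qed.

(** * The category of presentations is a thin groupoid *)

Section Presentations.
Context (R : realType) (X : metricType R) (k : nat).
Implicit Types A B : pow_pres X k.

Lemma pp_coordK A (x : X) : pp_map A (fun j => pp_coord A j x) = x.
Proof. exact: inverseKV. Qed.

Lemma pp_coord_surj A (j : 'I_k) (p : pp_space A) :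
  exists x, pp_coord A j x = p.
Proof. by exists (pp_map A (fun=> p)); rewrite pp_coord_map. Qed.

(** The converse of [pp_hom_coord]: composing the equations for all [j] gives
    f^k o phi^-1 = psi^-1, which is the compatibility psi o f^k = phi. *)
Lemma pp_hom_compat A B (f : pp_space A -> pp_space B) :
  (forall j x, f (pp_coord A j x) = pp_coord B j x) ->
  pp_map B \o @power_map R k _ _ f = pp_map A.
Proof.
move=> fE; apply/funext => p /=; rewrite -[RHS](pp_coordK B).
congr (pp_map B); apply/funext => j.
by rewrite -fE pp_coord_map.
Qed.

(** The index [i] only witnesses that there is a coordinate at all: for
    [k = 0] every isometry of [P] is an automorphism. *)
Lemma PowPresCat_thin (i : 'I_k) : thin (PowPresCat X k).
Proof.
move=> A B f g; apply: pp_hom_ext => p.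
by have [x <-] := pp_coord_surj i p; rewrite -!(pp_hom_coord _ i x).
Qed.

Lemma pp_hom_iso A B (f : pp_hom A B) :
  @is_iso (PowPresCat X k) A B f.
Proof.
have bf := proj1 (pp_fun_isometry f).
have ginv : @pp_map R X k A \o @power_map R k _ _ (inverse bf) = pp_map B.
  by apply: pp_hom_compat => j x; rewrite (pp_hom_coord f) inverseK.
exists (PPHom (is_isometry_inverse (pp_fun_isometry f) bf) ginv).
by split; apply: pp_hom_ext => p /=; [exact: inverseK|exact: inverseKV].
Qed.

End Presentations.

(** * The two composites *)

Section Composites.
Context (R : realType) (X : metricType R) (X0 : [set: X] !=set0).
Context (k : nat) (hk : (2 <= k)%N).
Local Notation i1 := (first_ord hk).
Implicit Types (s : pow_str X hk) (A : pow_pres X k).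

Lemma pp_coord_G s (j : 'I_k) (x : X) :
  pp_coord (G_ob X0 s) j x = ps_Psi s x j.
Proof.
rewrite -(pp_coord_map (A := G_ob X0 s) j (ps_Psi s x)) /=.
by rewrite inverseK.
Qed.

Lemma ps_Psi_pos s (x : X) (j : 'I_k) (hj : (0 < j)%N) :
  ps_Psi s x j = ps_tau hj (cls (ps_rel s j) x).
Proof.
rewrite /ps_Psi; case: pselect => // hj'.
by rewrite (Prop_irrelevance hj' hj).
Qed.

Lemma ps_Psi_first s (x : X) : ps_Psi s x i1 = cls (ps_rel s i1) x.
Proof. by rewrite /ps_Psi; case: pselect. Qed.

(** Distances between j-th coordinates are quotient distances
    ([ps_Psi_dist]), and these separate the classes. *)
Lemma ps_Psi_eqP s (j : 'I_k) (x y : X) :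
  ps_Psi s x j = ps_Psi s y j <-> ps_rel s j x y.
Proof.
rewrite -(cls_eqP x y (ps_equiv s j)) -(is_metric_eq0 (ps_metric s j)).
rewrite -ps_Psi_dist; split=> [->|]; first exact: mdistxx.
exact: mdist_positivity.
Qed.

Lemma F_G_ob s : F_ob hk (G_ob X0 s) = s.
Proof.
apply: pow_str_ext => [j x y|j hj x y] /=.
  by rewrite /pp_rel !pp_coord_G ps_Psi_eqP.
by move=> /pp_tauP; rewrite !pp_coord_G ps_Psi_first (ps_Psi_pos _ _ hj).
Qed.

Lemma pp_qbar_Psi A (x : X) (j : 'I_k) :
  pp_qbar (ps_Psi (F_ob hk A) x j) = pp_coord A j x.
Proof.
have [hj|/(ord_eq_first hk) ->] := pselect (0 < j)%N; last first.
  by rewrite ps_Psi_first pp_qbar_cls.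
by rewrite (ps_Psi_pos _ _ hj) /= /pp_tau /= inverseKV pp_qbar_cls.
Qed.

Fact pp_eta_compat A :
  pp_map A \o @power_map R k (pp_space (G_ob X0 (F_ob hk A))) _
    (@pp_qbar R X k A i1) = pp_map (G_ob X0 (F_ob hk A)).
Proof. by apply: pp_hom_compat => j x; rewrite pp_coord_G pp_qbar_Psi. Qed.

Definition pp_eta A : pp_hom (G_ob X0 (F_ob hk A)) A :=
  @PPHom R X k (G_ob X0 (F_ob hk A)) A (@pp_qbar R X k A i1)
    (pp_qbar_isometry A i1) (pp_eta_compat A).

Definition pp_eta_iso :
    nat_iso (functor_comp (G_functor hk X0) (F_functor X hk))
            (functor_id (PowPresCat X k)) :=
  @NatIso _ _ (functor_comp (G_functor hk X0) (F_functor X hk))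
    (functor_id (PowPresCat X k)) pp_eta
    (fun _ _ _ => PowPresCat_thin i1 _ _) (fun A => pp_hom_iso (pp_eta A)).

End Composites.

Theorem theorem4p21 (R : realType) (X : metricType R) (X0 : [set: X] !=set0)
    (k : nat) (hk : (2 <= k)%N) :
  let F := F_functor X hk in
  let G := G_functor hk X0 in
  [/\ is_equivalence F G,
      functor_comp F G = functor_id (PowStrCat X hk),
      (exists eta : nat_iso (functor_comp G F) (functor_id (PowPresCat X k)),
         forall A : PowPresCat X k,
           pp_fun (eta A) = @pp_qbar R X k A (first_ord hk)),
      (exists b : iso_classes (PowPresCat X k) -> PowStrCat X hk,
         bijective b /\
         forall A : PowPresCat X k, b (iso_class A) = F A) &
      thin (PowPresCat X k) /\
      forall A : PowPresCat X k, trivial_aut A].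
Proof.
move=> F G.
have FG : functor_comp F G = functor_id (PowStrCat X hk).
  by apply: functor_discrete_ext => s; exact: F_G_ob.
have FGequiv : is_equivalence F G.
  by split; [constructor; exact: pp_eta_iso|exact: nat_iso_of_eq].
have Pthin := PowPresCat_thin (X := X) (first_ord hk).
split=> //.
- by exists (pp_eta_iso X0 hk).
- exact: equivalence_discrete_iso_classes FGequiv.
- by split=> // A; exact: thin_trivial_aut.
Qed.
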